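(* The logarithmic monodromies of the bundle $(\mathrm{DET}\,\mathrm D)^*\to\overset{\circ}{\mathrm{UP}}$ are $$\eta^0_{\mathrm D}[\gamma_n]=-\frac23\quad(1\le n\le N_f+2),\qquad \eta^0_{\mathrm D}[\gamma_\infty]=-\frac{2(10-N_f)}{3}.$$
   Context: Setting. Fix $N_f\in\{0,1,2,3,4\}$. Let $g_2,g_3\in\mathbb{C}[u]$ be polynomials of degree at most $2$ and $3$ respectively, such that the discriminant $\mathbf{\Delta}_u(u)=g_2^3-27g_3^2$ is a polynomial of degree $N_f+2$ with $N_f+2$ distinct (simple) zeros $u_1^*,\dots,u^*_{N_f+2}$, and such that the associated Weierstrass fibration over $\mathbb{CP}^1$ with fibers $E_u:\ y^2=4x^3-g_2(u)x-g_3(u)$ has a fiber of Kodaira type $I^*_{4-N_f}$ over $u=\infty$. $\overset{\circ}{\mathrm{UP}}$ denotes $\mathbb{CP}^1$ with small open discs around $u_1^*,\dots,u^*_{N_f+2}$ and $\infty$ removed. Near infinity use $v$ with $u=-1/v$, $x_v=v^2x_u$, $y_v=-v^3y_u$, so $dz_u=dx_u/y_u=-v\,dz_v$ and the discriminant is $\mathbf\Delta_v=v^{12}\mathbf\Delta_u$. The signature operator along the fiber is $\mathrm D=\bar\partial+\bar\partial_1:\Omega^{0,0}(E_u)\oplus\Omega^{1,0}(E_u)\to\Omega^{0,1}(E_u)\oplus\Omega^{1,1}(E_u)$; its determinant line bundle $\mathrm{DET}\,\mathrm D$ has fibers identified with $[H^{1,0}(E_u)]^{-2}$, with holomorphic frame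 $\sigma_{\mathrm D}=(dz)^{-2}$, and flat connection $\nabla^{\mathrm{BF}}\sigma_{\mathrm D}=\frac16\frac{d\mathbf\Delta}{\mathbf\Delta}\otimes\sigma_{\mathrm D}$. The identification of $(dz)^2$ with $du^{-1}$ (resp. $(dz_v)^2$ with $dv^{-1}$) gives a distinguished trivialization of $(\mathrm{DET}\,\mathrm D)^*\otimes T^*\mathrm{UP}$ in which the holomorphic unit-norm section $\mathbf\Delta^{1/6}(dz)^2$ of $(\mathrm{DET}\,\mathrm D)^*$ is represented by $\mathbf\Delta^{1/6}$. This singles out a logarithm of the holonomy: writing the holonomy along $\gamma$ (the factor by which parallel transport along $\gamma$ multiplies $\sigma_{\mathrm D}$) as $\exp(-\frac{\pi i}{2}\eta^0_{\mathrm D}[\gamma])$, the logarithmic monodromy $\eta^0_{\mathrm D}[\gamma]\in\mathbb R$ is defined (exactly, not only modulo $4$) by $$-\frac{\pi i}{2}\,\eta^0_{\mathrm D}[\gamma]=-\frac16\oint_\gamma\frac{d\mathbf\Delta}{\mathbf\Delta},$$ with $\mathbf\Delta=\mathbf\Delta_u$ for $\gamma=\gamma_n$ and $\mathbf\Delta=\mathbf\Delta_v$ for $\gamma=\gamma_\infty$. Here $\gamma_n$ is a small circle around $u_n^*$ oriented clockwise, and $\gamma_\infty$ is a circle around infinity oriented counterclockwise in the $u$-plane (clockwise around $v=0$). *)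

(* Defs.v *)
From HB Require Import structures.
From mathcomp Require Import all_boot all_order all_algebra.
From mathcomp Require Import all_classical all_reals all_analysis.

Set Implicit Arguments.
Unset Strict Implicit.
Unset Printing Implicit Defensive.

Import Order.TTheory GRing.Theory Num.Theory.
Import numFieldNormedType.Exports.
From mathcomp Require Import complex.

Local Open Scope classical_set_scope.
Local Open Scope ring_scope.
Local Open Scope complex_scope.

(* A Weierstrass fibration y^2 = 4 x^3 - g2 x - g3 over an affine chart of the
   projective line; g2 and g3 are polynomials in the chart coordinate. *)
Record weierstrass (F : fieldType) := Weierstrass { wg2 : {poly F} ; wg3 : {poly F} }.

Definition discriminant (F : fieldType) (W : weierstrass F) : {poly F} :=
  wg2 W ^+ 3 - 27%:R *: wg3 W ^+ 2.

(* The polynomial v^n p(-1/v), for p of degree at most n (see [inftyE]). *)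
Definition infty_poly (F : fieldType) (n : nat) (p : {poly F}) : {poly F} :=
  \poly_(i < n.+1) ((-1) ^+ (n - i) * p`_(n - i)).

(* The model over the chart v = -1/u.  Substituting x_v = v^2 x_u and
   y_v = - v^3 y_u turns y_u^2 = 4 x_u^3 - g2(u) x_u - g3(u) into
   y_v^2 = 4 x_v^3 - v^4 g2(-1/v) x_v - v^6 g3(-1/v). *)
Definition infty_chart (F : fieldType) (W : weierstrass F) : weierstrass F :=
  Weierstrass (infty_poly 4 (wg2 W)) (infty_poly 6 (wg3 W)).

Lemma inftyE (F : fieldType) (n : nat) (p : {poly F}) (v : F) :
  (size p <= n.+1)%N -> v != 0 -> (infty_poly n p).[v] = v ^+ n * p.[- v^-1].
Proof.
move=> sp v0; rewrite horner_poly (horner_coef_wide _ sp) mulr_sumr.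
rewrite (reindex_inj rev_ord_inj) /=; apply: eq_bigr => i _.
have le_in : (i <= n)%N by rewrite -ltnS.
rewrite subSS subKn // -[- v^-1]mulN1r exprMn exprVn expfB_cond.
  rewrite [_ * p`_i]mulrC -mulrA [_ * (v ^+ n / _)]mulrCA; exact: mulrCA.
by rewrite (negbTE v0).
Qed.

Lemma discriminant_infty (F : fieldType) (W : weierstrass F) (v : F) :
  (size (wg2 W) <= 5)%N -> (size (wg3 W) <= 7)%N -> v != 0 ->
  (discriminant (infty_chart W)).[v] = v ^+ 12 * (discriminant W).[- v^-1].
Proof.
move=> s2 s3 v0; rewrite /discriminant !(hornerD, hornerN, hornerZ, horner_exp) /=.
rewrite !inftyE // (exprMn 3) (exprMn 2) -!exprM mulrBr.
by congr (_ - _); exact: mulrCA.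
Qed.

Definition vanishes_to (F : fieldType) (p : {poly F}) (a : F) (n : nat) : bool :=
  ('X - a%:P) ^+ n %| p.

Definition vanishing_order (F : fieldType) (p : {poly F}) (a : F) (n : nat) : bool :=
  vanishes_to p a n && ~~ vanishes_to p a n.+1.

Inductive kodaira_type :=
  KI of nat | KII | KIII | KIV | KIstar of nat | KIVstar | KIIIstar | KIIstar.

(* Kodaira's classification of the fiber over the point a of (the minimal
   resolution of) a minimal Weierstrass fibration in characteristic 0, by the
   orders of vanishing of g2, g3 and the discriminant at a.  No line of the
   table applies when the model is not minimal at a. *)
Definition has_fiber (F : fieldType) (W : weierstrass F) (a : F)
    (k : kodaira_type) : bool :=
  let ge2 := vanishes_to (wg2 W) a in
  let ge3 := vanishes_to (wg3 W) a in
  let eq2 := vanishing_order (wg2 W) a in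
  let eq3 := vanishing_order (wg3 W) a in
  let eqD := vanishing_order (discriminant W) a in
  (match k with
   | KI 0      => eqD 0
   | KI n      => [&& eq2 0, eq3 0 & eqD n]
   | KII       => [&& ge2 1, eq3 1 & eqD 2]
   | KIII      => [&& eq2 1, ge3 2 & eqD 3]
   | KIV       => [&& ge2 2, eq3 2 & eqD 4]
   | KIstar 0  => [&& ge2 2, ge3 3 & eqD 6]
   | KIstar n  => [&& eq2 2, eq3 3 & eqD (6 + n)]
   | KIVstar   => [&& ge2 3, eq3 4 & eqD 8]
   | KIIIstar  => [&& eq2 3, ge3 5 & eqD 9]
   | KIIstar   => [&& ge2 4, eq3 5 & eqD 10]
   end)%N.

Definition cexp (R : realType) (z : R[i]) : R[i] :=
  (expR (Re z))%:C * (cos (Im z) +i* sin (Im z)).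

(* Paths and loops are parametrized by [0, 1]. *)
Definition ccw_circle (R : realType) (c : R[i]) (r : R) (t : R) : R[i] :=
  c + r%:C * cexp (0 +i* (2 * pi * t)).

Definition cw_circle (R : realType) (c : R[i]) (r : R) (t : R) : R[i] :=
  c + r%:C * cexp (0 -i* (2 * pi * t)).

Definition path_deriv (R : realType) (g : R -> R[i]) (t : R) : R[i] :=
  derive1 (fun x => Re (g x)) t +i* derive1 (fun x => Im (g x)) t.

Definition contour_integral (R : realType) (f : R[i] -> R[i]) (g : R -> R[i]) : R[i] :=
  (\int[lebesgue_measure]_(t in `[0%R, 1%R]) Re (f (g t) * path_deriv g t))%R
  +i* (\int[lebesgue_measure]_(t in `[0%R, 1%R]) Im (f (g t) * path_deriv g t))%R.

(* In the frame sigma_D = (dz)^(-2) of DET D, with fibers [H^{1,0}]^(-2), the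
   connection nabla^BF is d + a with a = (1/6) dDelta/Delta.  This is the
   coefficient of a with respect to the chart coordinate. *)
Definition BF_form (R : realType) (W : weierstrass R[i]) (z : R[i]) : R[i] :=
  6%:R^-1 * ((discriminant W)^`().[z] / (discriminant W).[z]).

(* s t is the coefficient, in the frame sigma_D, of a section of DET D along g. *)
Definition BF_parallel (R : realType) (W : weierstrass R[i]) (g s : R -> R[i]) : Prop :=
  [/\ derivable_oo_LRcontinuous (fun t => Re (s t)) 0 1,
      derivable_oo_LRcontinuous (fun t => Im (s t)) 0 1
    & forall t : R, 0 < t < 1 ->
        path_deriv s t + BF_form W (g t) * path_deriv g t * s t = 0].

(* Parallel transport along the loop g takes sigma_D to h * sigma_D. *)
Definition BF_holonomy (R : realType) (W : weierstrass R[i]) (g : R -> R[i])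
    (h : R[i]) : Prop :=
  exists s : R -> R[i], [/\ BF_parallel W g s, s 0 = 1 & s 1 = h].

(* eta is the logarithmic monodromy eta^0_D[g]: the holonomy is
   exp(- (pi i / 2) eta), and among the logarithms of the holonomy
   - (pi i / 2) eta is the one given by the function Delta^(1/6) that
   represents the section Delta^(1/6) (dz)^2 of the dual bundle. *)
Definition log_monodromy (R : realType) (W : weierstrass R[i]) (g : R -> R[i])
    (eta : R) : Prop :=
  BF_holonomy W g (cexp (- (0 +i* (pi / 2)) * eta%:C)) /\
  - (0 +i* (pi / 2)) * eta%:C = - contour_integral (BF_form W) g.

(* Main.v *)
(* Both loops are clockwise circles c + w0 exp(-2 pi i t), in the u- and in the
   v-coordinate, and the discriminant has the form
   K (z - c)^m prod_b (1 - b (z - c)) with |b w0| < 1: m = 1 at u_n^*, and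
   m = 12 - (Nf + 2) = 10 - Nf at infinity because of the factor v^12.  On the
   circle each 1 - b (z - c) stays in the right half plane, where the principal
   logarithm is a single-valued primitive, so only (z - c)^m contributes to the
   integral of dDelta/Delta.  The exponential of minus the resulting explicit
   primitive of the connection form is the parallel section. *)

Require Import Defs.
From HB Require Import structures.
From mathcomp Require Import all_boot all_order all_algebra.
From mathcomp Require Import all_classical all_reals all_analysis.
Import Order.TTheory GRing.Theory Num.Theory.
Import numFieldNormedType.Exports.
From mathcomp Require Import complex.
From mathcomp Require Import ring.
Set Implicit Arguments.
Unset Strict Implicit.
Unset Printing Implicit Defensive.
Local Open Scope ring_scope.
Local Open Scope complex_scope.

(** * Complex arithmetic in real and imaginary parts *)

Lemma eq_complex_ReIm (R : rcfType) (x y : R[i]) : Re x = Re y -> Im x = Im y -> x = y.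
Proof. by case: x y => [a b] [c d] /= -> ->. Qed.

Lemma Re_addc (R : rcfType) (x y : R[i]) : Re (x + y) = Re x + Re y.
Proof. by case: x y => [a b] [c d]. Qed.

Lemma Im_addc (R : rcfType) (x y : R[i]) : Im (x + y) = Im x + Im y.
Proof. by case: x y => [a b] [c d]. Qed.

Lemma Re_mulc (R : rcfType) (x y : R[i]) : Re (x * y) = Re x * Re y - Im x * Im y.
Proof. by case: x y => [a b] [c d]. Qed.

Lemma Im_mulc (R : rcfType) (x y : R[i]) : Im (x * y) = Re x * Im y + Im x * Re y.
Proof. by case: x y => [a b] [c d] /=; rewrite addrC. Qed.

Lemma Re_invc (R : rcfType) (x : R[i]) : Re x^-1 = Re x / (Re x ^+ 2 + Im x ^+ 2).
Proof. by case: x. Qed.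

Lemma Im_invc (R : rcfType) (x : R[i]) : Im x^-1 = - (Im x / (Re x ^+ 2 + Im x ^+ 2)).
Proof. by case: x. Qed.

(** * Calculus of complex-valued functions of a real variable *)

Section PathCalculus.
Variable R : realType.
Implicit Types f g : R -> R[i].

(** Componentwise, to match [path_deriv] and [contour_integral]; unlike [path_deriv], it also
    records that the derivative exists. *)
Definition is_cderive f (t : R) (d : R[i]) : Prop :=
  is_derive t (1 : R) (fun x => Re (f x)) (Re d) /\
  is_derive t (1 : R) (fun x => Im (f x)) (Im d).

Lemma is_cderive_path_deriv f t d : is_cderive f t d -> path_deriv f t = d.
Proof.
case=> fR fI; apply: eq_complex_ReIm; rewrite /path_deriv /= derive1E; exact: derive_val.
Qed.

Lemma is_cderive_cst (c : R[i]) t : is_cderive (fun=> c) t 0.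
Proof. by split; apply: is_derive_cst. Qed.

Lemma is_cderiveD f g t df dg : is_cderive f t df -> is_cderive g t dg ->
  is_cderive (fun x => f x + g x) t (df + dg).
Proof.
move=> [fR fI] [gR gI]; split.
- rewrite (_ : (fun x => _) = (fun x => Re (f x)) + (fun x => Re (g x))).
    by rewrite (Re_addc, Im_addc); apply: is_deriveD.
  by apply/funext => x; rewrite (Re_addc, Im_addc).
- rewrite (_ : (fun x => _) = (fun x => Im (f x)) + (fun x => Im (g x))).
    by rewrite (Re_addc, Im_addc); apply: is_deriveD.
  by apply/funext => x; rewrite (Re_addc, Im_addc).
Qed.

Lemma is_cderiveM f g t df dg : is_cderive f t df -> is_cderive g t dg ->
  is_cderive (fun x => f x * g x) t (df * g t + f t * dg).
Proof.
move=> [fR fI] [gR gI]; split.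
- rewrite (_ : (fun x => _) = (fun x => Re (f x)) * (fun x => Re (g x))
     - (fun x => Im (f x)) * (fun x => Im (g x))).
    apply: is_derive_eq.
    rewrite /GRing.scale /= !(Re_addc, Re_mulc); ring.
  by apply/funext => x; rewrite Re_mulc.
- rewrite (_ : (fun x => _) = (fun x => Re (f x)) * (fun x => Im (g x))
     + (fun x => Im (f x)) * (fun x => Re (g x))).
    apply: is_derive_eq.
    rewrite /GRing.scale /= !(Im_addc, Im_mulc); ring.
  by apply/funext => x; rewrite Im_mulc.
Qed.

Lemma is_cderive_sum (I : Type) (r : seq I) (P : pred I) (F : I -> R -> R[i])
    (dF : I -> R[i]) t : (forall i, P i -> is_cderive (F i) t (dF i)) ->
  is_cderive (fun x => \sum_(i <- r | P i) F i x) t (\sum_(i <- r | P i) dF i).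
Proof.
move=> FdF; elim: r => [|i r IH].
  rewrite big_nil (_ : (fun x => _) = fun=> 0); first exact: is_cderive_cst.
  by apply/funext => x; rewrite big_nil.
rewrite big_cons (_ : (fun x => _) = fun x => if P i then F i x + \sum_(j <- r | P j) F j x
    else \sum_(j <- r | P j) F j x); last by apply/funext => x; rewrite big_cons.
by case: ifP => // Pi; apply: is_cderiveD => //; apply: FdF.
Qed.

Lemma is_cderive_cexp f t df : is_cderive f t df ->
  is_cderive (fun x => cexp (f x)) t (cexp (f t) * df).
Proof.
move=> [fR fI].
have dE : is_derive t (1 : R) (expR \o (fun x => Re (f x))) (expR (Re (f t)) * Re df).
  exact: is_derive1_comp.
have dC : is_derive t (1 : R) (cos \o (fun x => Im (f x))) (- sin (Im (f t)) * Im df).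
  exact: is_derive1_comp.
have dS : is_derive t (1 : R) (sin \o (fun x => Im (f x))) (cos (Im (f t)) * Im df).
  exact: is_derive1_comp.
split.
- rewrite (_ : (fun x => _) = (expR \o (fun x => Re (f x))) * (cos \o (fun x => Im (f x)))).
    apply: is_derive_eq; rewrite /GRing.scale /= /cexp !(Re_mulc, Im_mulc) /=; ring.
  by apply/funext => x; rewrite /cexp Re_mulc /= mul0r subr0.
- rewrite (_ : (fun x => _) = (expR \o (fun x => Re (f x))) * (sin \o (fun x => Im (f x)))).
    apply: is_derive_eq; rewrite /GRing.scale /= /cexp !(Re_mulc, Im_mulc) /=; ring.
  by apply/funext => x; rewrite /cexp Im_mulc /= mul0r addr0.
Qed.

(* The principal branch, meaningful on the half plane [Re z > 0] only. *)
Definition cln (z : R[i]) : R[i] :=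
  (ln (Re z ^+ 2 + Im z ^+ 2) / 2) +i* atan (Im z / Re z).

(** The two components are half the logarithm of the squared modulus and the angle; their
    derivatives recombine into [df] times the conjugate of [f t] over the squared modulus. *)
Lemma is_cderive_cln f t df : 0 < Re (f t) -> is_cderive f t df ->
  is_cderive (fun x => cln (f x)) t (df / f t).
Proof.
move=> f0 [fR fI].
have n0 : 0 < Re (f t) ^+ 2 + Im (f t) ^+ 2.
  by rewrite ltr_pwDl ?exprn_gt0 ?sqr_ge0.
have f0' : Re (f t) != 0 by rewrite gt_eqF.
split.
- have dN : is_derive t (1 : R) ((fun x => Re (f x)) ^+ 2 + (fun x => Im (f x)) ^+ 2)
      (2 * (Re (f t) * Re df + Im (f t) * Im df)).
    by apply: is_derive_eq; rewrite /GRing.scale /=; ring.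
  have dL := is_derive1_ln n0.
  have dLN := @is_derive1_comp R (@ln R) _ t _ _ dL dN.
  rewrite (_ : (fun x => _) =
      2^-1 *: (@ln R \o ((fun x => Re (f x)) ^+ 2 + (fun x => Im (f x)) ^+ 2))).
    apply: is_derive_eq; rewrite Re_mulc Re_invc Im_invc /GRing.scale /=; field.
    by rewrite gt_eqF.
  by apply/funext => x; rewrite /cln /= mulrC.
- have dV := is_deriveV f0' fR.
  have dM := is_deriveM fI dV.
  have dA := @is_derive1_comp R (@atan R) _ t _ _ (is_derive1_atan _) dM.
  rewrite (_ : (fun x => _) = (@atan R \o ((fun x => Im (f x)) * (fun x => (Re (f x))^-1)))) //.
  apply: is_derive_eq; rewrite Im_mulc Re_invc Im_invc /GRing.scale /=.
  rewrite -[X in 1 + X ^+ 2]/(Im (f t) / Re (f t)); field.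
  by rewrite f0' andbT gt_eqF.
Qed.

Definition ccontinuous f : Prop :=
  continuous (fun x => Re (f x)) /\ continuous (fun x => Im (f x)).

Lemma is_cderive_ccontinuous f (df : R -> R[i]) :
  (forall t, is_cderive f t (df t)) -> ccontinuous f.
Proof.
by move=> fdf; split=> t; apply/differentiable_continuous/derivable1_diffP;
  have [fR fI] := fdf t; apply: ex_derive.
Qed.

Lemma ccontinuous_cst (c : R[i]) : ccontinuous (fun=> c).
Proof. by split=> t; apply: cvg_cst. Qed.

Lemma ccontinuousD f g :
  ccontinuous f -> ccontinuous g -> ccontinuous (fun x => f x + g x).
Proof.
move=> [fR fI] [gR gI]; split=> t.
- rewrite (_ : (fun x => _) = (fun x => Re (f x)) + (fun x => Re (g x))).
    by apply: continuousD; [apply: fR|apply: gR].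
  by apply/funext => x; rewrite (Re_addc, Im_addc).
- rewrite (_ : (fun x => _) = (fun x => Im (f x)) + (fun x => Im (g x))).
    by apply: continuousD; [apply: fI|apply: gI].
  by apply/funext => x; rewrite (Re_addc, Im_addc).
Qed.

Lemma ccontinuousM f g :
  ccontinuous f -> ccontinuous g -> ccontinuous (fun x => f x * g x).
Proof.
move=> [fR fI] [gR gI]; split=> t.
- rewrite (_ : (fun x => _) = (fun x => Re (f x)) * (fun x => Re (g x))
     - (fun x => Im (f x)) * (fun x => Im (g x))).
    by apply: continuousB; apply: continuousM; by [apply: fR|apply: gR|apply: fI|apply: gI].
  by apply/funext => x; rewrite Re_mulc.
- rewrite (_ : (fun x => _) = (fun x => Re (f x)) * (fun x => Im (g x))
     + (fun x => Im (f x)) * (fun x => Re (g x))).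
    by apply: continuousD; apply: continuousM; by [apply: fR|apply: gR|apply: fI|apply: gI].
  by apply/funext => x; rewrite Im_mulc.
Qed.

Lemma ccontinuousV f :
  (forall t, f t != 0) -> ccontinuous f -> ccontinuous (fun x => (f x)^-1).
Proof.
move=> f0 [fR fI].
have n0 t : Re (f t) ^+ 2 + Im (f t) ^+ 2 != 0.
  rewrite paddr_eq0 ?sqr_ge0// !sqrf_eq0; apply: contra (f0 t) => /andP[/eqP R0 /eqP I0].
  exact/eqP/eq_complex_ReIm.
have cV : continuous (fun x => (Re (f x) ^+ 2 + Im (f x) ^+ 2)^-1).
  move=> t; apply: cvgV => //.
  apply: cvgD; apply: continuousM; by [apply: fR|apply: fI].
split=> t.
- rewrite (_ : (fun x => _) = (fun x => Re (f x)) * (fun x => (Re (f x) ^+ 2 + Im (f x) ^+ 2)^-1)).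
    by apply: continuousM; [apply: fR|apply: cV].
  by apply/funext => x; rewrite Re_invc.
- rewrite (_ : (fun x => _) =
      - ((fun x => Im (f x)) * (fun x => (Re (f x) ^+ 2 + Im (f x) ^+ 2)^-1))).
    by apply: continuousN; apply: continuousM; [apply: fI|apply: cV].
  by apply/funext => x; rewrite Im_invc.
Qed.

Lemma ccontinuous_horner (p : {poly R[i]}) f :
  ccontinuous f -> ccontinuous (fun x => p.[f x]).
Proof.
move=> fc; elim/poly_ind: p => [|p c IH].
  rewrite (_ : (fun x => _) = fun=> 0); first exact: ccontinuous_cst.
  by apply/funext => x; rewrite horner0.
rewrite (_ : (fun x => _) = fun x => p.[f x] * f x + c).
  by apply: ccontinuousD; [apply: ccontinuousM|apply: ccontinuous_cst].
by apply/funext => x; rewrite hornerMXaddC.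
Qed.

(** The primitives and parallel sections below are differentiable on the whole line, so the
    one-sided limits at the endpoints come from continuity. *)
Lemma derivable_oo_LRcontinuous_derive (F dF : R -> R) (a b : R) :
  (forall t, is_derive t (1 : R) F (dF t)) -> derivable_oo_LRcontinuous F a b.
Proof.
move=> FdF.
have Fc : continuous F.
  by move=> t; apply/differentiable_continuous/derivable1_diffP; apply: ex_derive.
by split=> [t _||]; [apply: ex_derive|apply: cvg_at_right_filter; apply: Fc
  |apply: cvg_at_left_filter; apply: Fc].
Qed.

Lemma Rintegral01_derive (F f : R -> R) : (forall t, is_derive t (1 : R) F (f t)) ->
  continuous f ->
  (\int[lebesgue_measure]_(t in `[0%R, 1%R]) f t)%R = F 1 - F 0.
Proof.
move=> Ff fc; rewrite /Rintegral (@continuous_FTC2 R f F) //.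
- exact: continuous_subspaceT.
- exact: derivable_oo_LRcontinuous_derive Ff.
- by move=> t _; rewrite derive1E; apply: derive_val.
Qed.

(** For a primitive [L] of the connection form along [g], the contour integral is [L 1 - L 0] and
    the parallel section is exp(L 0 - L t). Both halves of [log_monodromy] thus depend on one
    increment. *)
Lemma log_monodromy_primitive (W : weierstrass R[i]) (g L : R -> R[i]) (eta : R) :
  (forall t, is_cderive L t (BF_form W (g t) * path_deriv g t)) ->
  ccontinuous (fun t => BF_form W (g t) * path_deriv g t) ->
  L 1 - L 0 = (0 +i* (pi / 2)) * eta%:C ->
  log_monodromy W g eta.
Proof.
move=> dL [cR cI] L01.
split; last first.
  rewrite mulNr -L01; congr (- _); apply: eq_complex_ReIm; rewrite /contour_integral /=.
  - by rewrite (Rintegral01_derive (fun t => proj1 (dL t)) cR) raddfB.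
  - by rewrite (Rintegral01_derive (fun t => proj2 (dL t)) cI) raddfB.
(* The constant [L 0] normalizes [s 0] to 1; writing [-1 * L t] lets the product rule apply. *)
pose s t := cexp (L 0 + -1 * L t).
have ds t : is_cderive s t (s t * (-1 * (BF_form W (g t) * path_deriv g t))).
  have := is_cderive_cexp (is_cderiveD (is_cderive_cst (L 0) t)
    (is_cderiveM (is_cderive_cst (-1) t) (dL t))).
  by rewrite mul0r !add0r.
exists s; split.
- split.
  + exact: derivable_oo_LRcontinuous_derive (fun t => proj1 (ds t)).
  + exact: derivable_oo_LRcontinuous_derive (fun t => proj2 (ds t)).
  + by move=> t _; rewrite (is_cderive_path_deriv (ds t)) mulN1r mulrN [s t * _]mulrC addNr.
- rewrite /s mulN1r subrr /cexp /= expR0 cos0 sin0.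
  by apply: eq_complex_ReIm; rewrite ?Re_mulc ?Im_mulc /=; ring.
- by rewrite /s mulN1r mulNr -L01 opprB.
Qed.

End PathCalculus.

(** * Logarithmic derivatives of polynomials *)

Section LogarithmicDerivative.
Variable F : fieldType.
Implicit Types p q : {poly F}.

(** For [p] the discriminant, this is [BF_form] without its factor 1/6. *)
Definition logderiv p (z : F) : F := p^`().[z] / p.[z].

Lemma logderivM p q z : p.[z] != 0 -> q.[z] != 0 ->
  logderiv (p * q) z = logderiv p z + logderiv q z.
Proof.
by move=> p0 q0; rewrite /logderiv derivM !(hornerD, hornerM); field; rewrite p0 q0.
Qed.

Lemma logderivZ k p z : k != 0 -> logderiv (k *: p) z = logderiv p z.
Proof. by move=> k0; rewrite /logderiv derivZ !hornerZ -mulf_div divff ?mul1r. Qed.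

Lemma logderiv_prod (I : eqType) (r : seq I) (P : I -> {poly F}) z :
  (forall i, i \in r -> (P i).[z] != 0) ->
  logderiv (\prod_(i <- r) P i) z = \sum_(i <- r) logderiv (P i) z.
Proof.
elim: r => [|i r IH] P0.
  by rewrite !big_nil /logderiv -[1]/(1%:P) derivC horner0 mul0r.
have Pr0 j : j \in r -> (P j).[z] != 0 by move=> jr; rewrite P0 // in_cons jr orbT.
rewrite !big_cons logderivM ?IH ?P0 ?mem_head //.
rewrite horner_prod prodf_seq_neq0; apply/allP => j jr /=; exact: Pr0.
Qed.

Lemma logderivX p z m : p.[z] != 0 -> logderiv (p ^+ m) z = m%:R * logderiv p z.
Proof.
move=> p0; elim: m => [|m IH].
  by rewrite expr0 /logderiv -[1]/(1%:P) derivC horner0 !mul0r.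
by rewrite exprS logderivM ?horner_exp ?expf_neq0 // IH -natr1 mulrDl mul1r addrC.
Qed.

End LogarithmicDerivative.

(** * Logarithmic monodromy along a clockwise circle *)

Section ClockwiseCircle.
Variable R : realType.

Lemma is_cderive_angle (t : R) :
  is_cderive (fun x => 0 -i* (2 * pi * x)) t (0 -i* (2 * pi)).
Proof.
split=> /=; first exact: is_derive_cst.
rewrite (_ : (fun x => _) = (- (2 * pi)) *: (@id R)).
  by apply: is_derive_eq; rewrite /GRing.scale /= mulr1.
by apply/funext => x /=; rewrite -mulNr.
Qed.

Lemma normc_cexp_imaginary (x : R) : `|cexp (0 +i* x)| = 1.
Proof. by rewrite /cexp /= expR0 mul1r normc_def /= cos2Dsin2 sqrtr1. Qed.

Lemma cexp_turn : cexp (0 -i* (2 * pi * 1)) = 1 :> R[i].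
Proof. by rewrite mulr1 /cexp /= expR0 mul1r cosN sinN mulr_natl cos2pi sin2pi oppr0. Qed.

(** The angle decreases by 2 pi, so the connection form integrates to (1/6) m (-2 pi i), which is
    (pi i / 2) times -2m/3. A complex [w0] leaves the starting point free: the loop at infinity
    starts on the negative real axis. *)
Lemma log_monodromy_circle (W : weierstrass R[i]) (K c w0 : R[i]) (m : nat)
    (bs : seq R[i]) :
  K != 0 -> w0 != 0 -> (forall b, b \in bs -> `|b * w0| < 1) ->
  discriminant W =
    K *: (('X - c%:P) ^+ m * \prod_(b <- bs) (1 - b *: ('X - c%:P))) ->
  log_monodromy W (fun t => c + w0 * cexp (0 -i* (2 * pi * t))) (- (2 * m%:R / 3)).
Proof.
move=> K0 w0_neq0 bs_lt1 DW.
pose w t := w0 * cexp (0 -i* (2 * pi * t)).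
pose w' t := w t * (0 -i* (2 * pi)).
have dw t : is_cderive w t (w' t).
  have := is_cderiveM (is_cderive_cst w0 t) (is_cderive_cexp (is_cderive_angle t)).
  by rewrite mul0r add0r mulrA.
have dz t : is_cderive (fun t => c + w t) t (w' t).
  by have := is_cderiveD (is_cderive_cst c t) (dw t); rewrite add0r.
have w_neq0 t : w t != 0.
  by rewrite mulf_neq0 // -normr_gt0 normc_cexp_imaginary.
(* The exponential has modulus 1, so the real part of [b * w t] is at most |b w0|. *)
have Re_gt0 b t : b \in bs -> 0 < Re (1 - b * w t).
  move=> /bs_lt1 b_lt1; rewrite raddfB /= subr_gt0.
  apply: le_lt_trans (ler_norm _) _; rewrite -ltcR; apply: le_lt_trans (normc_ge_Re _) _.
  by rewrite mulrA normrM normc_cexp_imaginary mulr1.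
have b_neq0 b t : b \in bs -> 1 - b * w t != 0.
  by move=> /(Re_gt0 b t); apply: contraTneq => ->; rewrite ltxx.
have Xc0 t : ('X - c%:P).[c + w t] = w t by rewrite hornerXsubC addrC addKr.
have Xb b t : (1 - b *: ('X - c%:P)).[c + w t] = 1 - b * w t.
  by rewrite hornerD hornerN hornerZ Xc0 hornerC.
have BFw t : BF_form W (c + w t) =
    6^-1 * (m%:R / w t + \sum_(b <- bs) (- b / (1 - b * w t))).
  rewrite /BF_form -/(logderiv _ _) DW logderivZ // logderivM; first last.
  - rewrite horner_prod prodf_seq_neq0; apply/allP => b bbs /=; rewrite Xb; exact: b_neq0.
  - by rewrite horner_exp expf_neq0 // Xc0.
  rewrite logderivX ?Xc0 // logderiv_prod; last by move=> b bbs; rewrite Xb; exact: b_neq0.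
  congr (_ * (_ + _)).
    by rewrite /logderiv derivXsubC Xc0 hornerC mul1r.
  apply: eq_bigr => b _; rewrite /logderiv Xb derivB derivZ derivXsubC.
  by rewrite -[1 in X in X - _]/(1%:P) derivC sub0r hornerN hornerZ hornerC mulr1.
(* The angle, which is not reduced modulo 2 pi, serves as a continuous logarithm of [w t] up to the
   constant log w0. The guard [b \in bs] hands membership, hence the half-plane bound, to
   [is_cderive_sum]. *)
pose L t := 6^-1 * (m%:R * (0 -i* (2 * pi * t)) + \sum_(b <- bs | b \in bs) cln (1 + - b * w t)).
apply: (@log_monodromy_primitive R _ _ L) => [t||].
- rewrite (is_cderive_path_deriv (dz t)) BFw.
  have dsum : is_cderive (fun t => \sum_(b <- bs | b \in bs) cln (1 + - b * w t)) t
      (\sum_(b <- bs | b \in bs) (- b * w' t / (1 + - b * w t))).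
    apply: is_cderive_sum => b bbs; apply: is_cderive_cln; first by rewrite mulNr Re_gt0.
    have := is_cderiveD (is_cderive_cst 1 t)
      (is_cderiveM (is_cderive_cst (- b) t) (dw t)).
    by rewrite mul0r !add0r.
  have := is_cderiveM (is_cderive_cst 6^-1 t) (is_cderiveD
    (is_cderiveM (is_cderive_cst m%:R t) (is_cderive_angle t)) dsum).
  rewrite !mul0r !add0r -mulrA; congr (is_cderive _ _ (_ * _)).
  rewrite [RHS]mulrDl mulr_suml -big_seq; congr (_ + _).
    by rewrite /w' mulrA divfK.
  by apply: eq_bigr => b _; rewrite [- b * w t]mulNr mulrAC.
(* Continuity of the integrand: a quotient of polynomials whose denominator has no zero on the
   circle. *)
- rewrite (_ : (fun t => _) = (fun t => 6^-1 *
    ((discriminant W)^`().[c + w t] * ((discriminant W).[c + w t])^-1) * w' t)); last first.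
    by apply/funext => t; rewrite (is_cderive_path_deriv (dz t)).
  have cw := is_cderive_ccontinuous dw.
  have cz := is_cderive_ccontinuous dz.
  apply: ccontinuousM; last by apply: ccontinuousM => //; apply: ccontinuous_cst.
  apply: ccontinuousM; first exact: ccontinuous_cst.
  apply: ccontinuousM; first exact: ccontinuous_horner.
  apply: ccontinuousV; last exact: ccontinuous_horner.
  move=> t; rewrite DW hornerZ mulf_neq0 // hornerM mulf_neq0 //.
    by rewrite horner_exp expf_neq0 // Xc0.
  by rewrite horner_prod prodf_seq_neq0; apply/allP => b bbs /=; rewrite Xb; exact: b_neq0.
(* The circle closes up, so the [cln] terms cancel and only the angle contributes. *)
- have w1 : w 1 = w 0.
    by rewrite /w cexp_turn mulr0 /cexp /= oppr0 cos0 sin0 expR0 mul1r.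
  rewrite /L w1 -mulrBr opprD addrACA subrr addr0 -mulrBr.
  have six : 6^-1 = (6^-1)%:C :> R[i] by rewrite fmorphV rmorph_nat.
  have mC : m%:R = (m%:R)%:C :> R[i] by rewrite rmorph_nat.
  by rewrite six mC; apply: eq_complex_ReIm; rewrite !(Re_mulc, Im_mulc) /=; field.
Qed.

End ClockwiseCircle.

(** * Factorizations of the discriminant in the two charts *)

(** The difference vanishes at 1, 2, ..., [size (p - q)], distinct and nonzero in characteristic 0:
    too many roots for a nonzero polynomial. This removes the point where -1/v is undefined. *)
Lemma poly_eq_off0 (F : numDomainType) (p q : {poly F}) :
  (forall v, v != 0 -> p.[v] = q.[v]) -> p = q.
Proof.
move=> pq; apply/subr0_eq.
apply: (@roots_geq_poly_eq0 _ _ [seq k.+1%:R | k <- iota 0 (size (p - q))]).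
- by apply/allP => _ /mapP[k _ ->]; rewrite rootE hornerD hornerN pq ?subrr.
- by rewrite map_inj_uniq ?iota_uniq // => i j /eqP; rewrite eqr_nat => /eqP[].
- by rewrite size_map size_iota.
Qed.

(** The [n] distinct roots exhaust the degree. *)
Lemma poly_eq_prod_simple_roots (F : fieldType) (n : nat) (p : {poly F}) (a : 'I_n -> F) :
  size p = n.+1 -> injective a -> (forall i, vanishes_to p (a i) 1) ->
  p = lead_coef p *: \prod_i ('X - (a i)%:P).
Proof.
move=> sp a_inj pa.
rewrite {1}(@all_roots_prod_XsubC _ p (codom a)).
- by rewrite big_image.
- by rewrite size_codom card_ord.
- by apply/allP => _ /codomP[i ->]; have := pa i; rewrite /vanishes_to expr1 root_factor_theorem.
- by rewrite uniq_rootsE; apply/injectiveP.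
Qed.

(** Normal form for the circle computation, with b = 1/(a - c): then |b w0| < 1 says that [a] lies
    outside the circle of radius |w0| around [c]. *)
Lemma scaled_monic_linear (F : fieldType) (a c : F) : a != c ->
  'X - a%:P = (c - a) *: (1 - (a - c)^-1 *: ('X - c%:P)).
Proof.
move=> ac; rewrite scalerBr scalerA -[c - a]opprB mulNr divff ?subr_eq0 //.
rewrite scaleN1r opprK -opprB opprK alg_polyC polyCB; ring.
Qed.

(** Each root contributes -1/v - a = -(1/v)(1 + a v). The factor v^12 absorbs the [n] inverse powers
    of v, and the signs collect into (-1)^n. *)
Lemma discriminant_infty_prod (F : numFieldType) (W : weierstrass F) (K : F) (n : nat)
    (a : 'I_n -> F) :
  (size (wg2 W) <= 5)%N -> (size (wg3 W) <= 7)%N -> (n <= 12)%N ->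
  discriminant W = K *: \prod_i ('X - (a i)%:P) ->
  discriminant (infty_chart W) =
    ((-1) ^+ n * K) *: ('X ^+ (12 - n) * \prod_i (1 + a i *: 'X)).
Proof.
move=> s2 s3 n12 DW; apply: poly_eq_off0 => v v0.
rewrite discriminant_infty // DW !hornerZ hornerM !horner_prod hornerXn.
rewrite (eq_bigr (fun i => - v^-1 * (1 + a i *: 'X).[v])); last first.
  by move=> i _; rewrite hornerXsubC hornerD hornerC hornerZ hornerX; field.
rewrite big_split /= prodr_const card_ord -[- v^-1]mulN1r exprMn exprVn.
have -> : v ^+ 12 = v ^+ (12 - n) * v ^+ n by rewrite -exprD subnK.
by field; rewrite expf_neq0.
Qed.

(** * The loops around the zeros and around infinity *)

Theorem lemma7p3 (R : realType) (Nf : nat) (g2 g3 : {poly R[i]})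
    (ustar : 'I_(Nf + 2) -> R[i]) :
  let Wu := Weierstrass g2 g3 in
  let Wv := infty_chart Wu in
  (Nf <= 4)%N ->
  (size g2 <= 3)%N ->
  (size g3 <= 4)%N ->
  size (discriminant Wu) = (Nf + 2).+1 ->
  injective ustar ->
  (forall n, vanishing_order (discriminant Wu) (ustar n) 1) ->
  has_fiber Wv 0 (KIstar (4 - Nf)) ->
  (forall (n : 'I_(Nf + 2)) (r : R), 0 < r ->
     (forall m, m != n -> r%:C < `|ustar m - ustar n|) ->
     log_monodromy Wu (cw_circle (ustar n) r) (- (2 / 3))) /\
  (forall r : R, 0 < r ->
     (forall n, `|ustar n| < r%:C) ->
     log_monodromy Wv (fun t => - (ccw_circle 0 r t)^-1)
       (- (2 * (10 - Nf%:R) / 3))).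
Proof.
move=> Wu Wv Nf4 sg2 sg3 sD ustar_inj ustar_zero _.
have DW := poly_eq_prod_simple_roots sD ustar_inj (fun n => proj1 (andP (ustar_zero n))).
set K := lead_coef _ in DW.
have K0 : K != 0 by rewrite lead_coef_eq0 -size_poly_eq0 sD.
split=> [n r r0 r_lt | r r0 lt_r].
- have un m : m != n -> ustar m != ustar n by apply: contra_neq => /ustar_inj.
  (* The inserted 1 is the multiplicity m of the simple zero. The other factors are normalized at
     [ustar n], and their values there go into the leading constant. *)
  rewrite -[X in - (X / 3)]mulr1.
  apply: (@log_monodromy_circle R Wu (K * \prod_(m | m != n) (ustar n - ustar m)) (ustar n)
    r%:C 1 [seq (ustar m - ustar n)^-1 | m <- index_enum 'I_(Nf + 2) & m != n]).
  + rewrite mulf_neq0 //; apply/prodf_neq0 => m mn.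
    by rewrite subr_eq0 eq_sym un.
  + by rewrite gt_eqF // ltcR.
  + move=> b /mapP[m]; rewrite mem_filter => /andP[mn _] ->.
    rewrite normrM normfV ltr_pdivrMl ?normr_gt0 ?subr_eq0 ?un // mulr1.
    by rewrite ger0_norm ?r_lt // lecR ltW.
  + rewrite DW (bigD1 n) //= -scalerA expr1; congr (_ *: _); rewrite scalerAr; congr (_ * _).
    rewrite big_map big_filter -scaler_prod.
    by apply: eq_bigr => m mn; apply: scaled_monic_linear; rewrite un.
(* The exponent of v appears as a truncated natural difference; the bound on [Nf] ensures that
   nothing is truncated. *)
- have -> : 10 - Nf%:R = (12 - (Nf + 2))%:R :> R.
    by rewrite natrB ?natrD; [ring|rewrite addn2 !ltnS (leq_trans Nf4)].
  (* Inversion reverses the direction: the image is a clockwise circle around v = 0 of radius 1/r,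
     starting at -1/r. *)
  have circleE t : - (ccw_circle 0 r t)^-1 = 0 + (- r%:C^-1) * cexp (0 -i* (2 * pi * t)).
    have E1 : cexp (0 +i* (2 * pi * t)) * cexp (0 -i* (2 * pi * t)) = 1.
      rewrite /cexp /= expR0 !mul1r cosN sinN; apply: eq_complex_ReIm.
        by rewrite Re_mulc /= mulrN opprK -!expr2 cos2Dsin2.
      by rewrite Im_mulc /=; ring.
    rewrite /ccw_circle !add0r invfM mulNr; congr (- (_ * _)).
    exact: mulr1_eq.
  rewrite (_ : (fun t => _) = fun t => 0 + (- r%:C^-1) * cexp (0 -i* (2 * pi * t))); last first.
    by apply/funext => t; exact: circleE.
  (* Here b = -u_m, so |b w0| = |u_m|/r, which is below 1 because the loop encloses every zero. *)
  apply: (@log_monodromy_circle R Wv ((-1) ^+ (Nf + 2) * K) 0 _ _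
    [seq - ustar m | m <- index_enum 'I_(Nf + 2)]).
  + by rewrite mulf_neq0 // signr_eq0.
  + by rewrite oppr_eq0 invr_eq0 gt_eqF // ltcR.
  + move=> b /mapP[m _ ->]; rewrite mulrNN normrM normfV.
    rewrite [`|r%:C|]ger0_norm; last by rewrite lecR ltW.
    by rewrite ltr_pdivrMr ?ltcR // mul1r; exact: lt_r.
  + rewrite (discriminant_infty_prod _ _ _ DW) ?subr0 /=.
    * by rewrite big_map; congr (_ *: (_ * _)); apply: eq_bigr => m _; rewrite scaleNr opprK.
    * exact: leq_trans sg2 _.
    * exact: leq_trans sg3 _.
    * by rewrite addn2 !ltnS (leq_trans Nf4).
Qed.
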